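(* Let $(X,\sigma,\tau)$ be a non-degenerate multipermutation square-free solution. Then $(X,\sigma,\tau)$ is decomposable.
   Context: A (set-theoretic) solution (of the Yang-Baxter equation) $(X,\sigma,\tau)$ is a set $X$ (of arbitrary cardinality) with maps $\sigma,\tau\colon X^2\to X$ such that, writing $\sigma_x(y)=\sigma(x,y)$ and $\tau_y(x)=\tau(x,y)$, the map $r\colon X^2\to X^2$, $r(x,y)=(\sigma_x(y),\tau_y(x))$ satisfies the braid relation $(\mathrm{id}\times r)(r\times \mathrm{id})(\mathrm{id}\times r)=(r\times \mathrm{id})(\mathrm{id}\times r)(r\times \mathrm{id})$ on $X^3$. It is non-degenerate if all $\sigma_x$ and all $\tau_y$ are bijections of $X$. It is square-free if $r(x,x)=(x,x)$ for every $x\in X$. Involutivity ($r^2=\mathrm{id}$) is not assumed. Retraction: for a non-degenerate solution let $x\sim y$ iff $\sigma_x=\sigma_y$ and $\tau_x=\tau_y$. It is known that $\sigma_{x^\sim}(y^\sim)=\sigma_x(y)^\sim$, $\tau_{y^\sim}(x^\sim)=\tau_y(x)^\sim$ are well defined on the set of $\sim$-classes and form a non-degenerate solution $\mathrm{Ret}(X,\sigma,\tau)$. Put $\mathrm{Ret}^0(X,\sigma,\tau)=(X,\sigma,\tau)$ and $\mathrm{Ret}^k(X,\sigma,\tau)=\mathrm{Ret}(\mathrm{Ret}^{k-1}(X,\sigma,\tau))$ for $k\ge 1$. The solution is a multipermutation solution if $\mathrm{Ret}^k(X,\sigma,\tau)$ has exactly one element for some integer $k\geq 0$; the least such $k$ is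 its multipermutation level. The orbits of a non-degenerate solution are the orbits on $X$ of the group of permutations generated by all $\sigma_x,\tau_x$ ($x\in X$). The solution is indecomposable if this group acts transitively on $X$, and decomposable otherwise.
   Formalization: The solution is assumed to have at least two elements, since the one-element solution is non-degenerate, square-free and multipermutation of level 0 but indecomposable. *)

(* Defs.v *)
From mathcomp Require Import all_boot boolp.

Set Implicit Arguments.
Unset Strict Implicit.
Unset Printing Implicit Defensive.

Local Open Scope quotient_scope.

(* [sigma S x y] is sigma_x(y) and [tau S x y] is tau_y(x): the subscript of
   tau is its second argument, so tau_y is the function [(tau S)^~ y]. *)
Record ybe_data := YbeData {
  carrier :> Type;
  sigma : carrier -> carrier -> carrier;
  tau : carrier -> carrier -> carrier }.

Definition ybe_map (S : ybe_data) (p : S * S) : S * S :=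
  (sigma p.1 p.2, tau p.1 p.2).

Definition map_l (T : Type) (r : T * T -> T * T) (t : T * T * T) : T * T * T :=
  let: (x, y, z) := t in ((r (x, y)).1, (r (x, y)).2, z).

Definition map_r (T : Type) (r : T * T -> T * T) (t : T * T * T) : T * T * T :=
  let: (x, y, z) := t in (x, (r (y, z)).1, (r (y, z)).2).

Definition is_solution (S : ybe_data) : Prop :=
  let r := @ybe_map S in
  map_r r \o map_l r \o map_r r =1 map_l r \o map_r r \o map_l r.

Definition non_degenerate (S : ybe_data) : Prop :=
  (forall x : S, bijective (@sigma S x)) /\
  (forall y : S, bijective ((@tau S)^~ y)).

Definition square_free (S : ybe_data) : Prop :=
  forall x : S, ybe_map (x, x) = (x, x).

Definition ret_rel (S : ybe_data) (x y : S) : Prop :=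
  sigma x =1 sigma y /\ (@tau S)^~ x =1 (@tau S)^~ y.

Definition ret_relb (S : ybe_data) : rel {eclassic {classic S}} :=
  fun x y => `[< @ret_rel S x y >].

Lemma ret_relb_refl (S : ybe_data) : reflexive (@ret_relb S).
Proof. by move=> x; apply/asboolP; split. Qed.

Lemma ret_relb_sym (S : ybe_data) : symmetric (@ret_relb S).
Proof.
by move=> x y; apply/asboolP/asboolP => -[s t]; split=> z; rewrite ?s ?t.
Qed.

Lemma ret_relb_trans (S : ybe_data) : transitive (@ret_relb S).
Proof.
move=> y x z /asboolP[s t] /asboolP[s' t']; apply/asboolP.
by split=> w; [rewrite s s' | rewrite (t w) (t' w)].
Qed.

Canonical ret_equiv (S : ybe_data) :=
  EquivRel (@ret_relb S) (@ret_relb_refl S) (@ret_relb_sym S)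
    (@ret_relb_trans S).

(* The set of classes of ~. *)
Definition ret_carrier (S : ybe_data) : Type := {eq_quot (ret_equiv S)}.

Definition ret_class (S : ybe_data) (x : S) : ret_carrier S :=
  \pi_{eq_quot (ret_equiv S)} x.

Definition ret_repr (S : ybe_data) (c : ret_carrier S) : S :=
  repr (c : {eq_quot (ret_equiv S)}).

(* The operations are computed on representatives, so that Ret is total; for
   non-degenerate solutions the choice is irrelevant, by [sigma_Ret] and
   [tau_Ret] below. *)
Definition Ret (S : ybe_data) : ybe_data :=
  @YbeData (ret_carrier S)
    (fun c d => ret_class (sigma (ret_repr c) (ret_repr d)))
    (fun c d => ret_class (tau (ret_repr c) (ret_repr d))).

Definition multipermutation (S : ybe_data) : Prop :=
  exists k : nat, exists x : iter k Ret S, forall y : iter k Ret S, y = x.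

(* The group of permutations of S generated by all sigma_x and tau_x. *)
Inductive perm_group (S : ybe_data) : (S -> S) -> Prop :=
| perm_group_sigma (x : S) : perm_group (@sigma S x)
| perm_group_tau (x : S) : perm_group ((@tau S)^~ x)
| perm_group_id : perm_group id
| perm_group_comp (f g : S -> S) :
    perm_group f -> perm_group g -> perm_group (f \o g)
| perm_group_inv (f g : S -> S) :
    perm_group f -> cancel f g -> cancel g f -> perm_group g.

Definition same_orbit (S : ybe_data) (x y : S) : Prop :=
  exists2 f : S -> S, perm_group f & f x = y.

Definition indecomposable (S : ybe_data) : Prop :=
  forall x y : S, same_orbit x y.

(* A one-point solution is indecomposable, although it is square-free and a
   multipermutation solution of level 0; statements about decomposability
   therefore have to assume at least two points. *)
Definition decomposable (S : ybe_data) : Prop := ~ indecomposable S.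

Lemma ret_classP (S : ybe_data) (x y : S) :
  ret_class x = ret_class y <-> ret_rel x y.
Proof. by split=> [/eqmodP/asboolP | H]; last exact/eqmodP/asboolP. Qed.

Lemma ret_reprK (S : ybe_data) (c : ret_carrier S) : ret_class (ret_repr c) = c.
Proof. exact: reprK. Qed.

Lemma ret_repr_class (S : ybe_data) (x : S) : ret_rel (ret_repr (ret_class x)) x.
Proof. by apply/ret_classP; rewrite ret_reprK. Qed.

Section WellDefined.
Variable S : ybe_data.
Hypotheses (solS : is_solution S) (ndS : non_degenerate S).

Lemma braid_sigma (x y z : S) :
  sigma x (sigma y z) = sigma (sigma x y) (sigma (tau x y) z).
Proof. by have [] := solS (x, y, z). Qed.

Lemma braid_tau (x y z : S) :
  tau (tau x y) z = tau (tau x (sigma y z)) (tau y z).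
Proof. by have [] := solS (x, y, z). Qed.

Lemma ret_rel_sigma (x x' y y' : S) :
  ret_rel x x' -> ret_rel y y' -> ret_rel (sigma x y) (sigma x' y').
Proof.
case: ndS => sb tb [sx _] [sy ty]; rewrite -(sx y').
have e : tau x y = tau x y' by apply: ty.
split=> w.
  have [g _ gK] := sb (tau x y); rewrite -(gK w) -braid_sigma e -braid_sigma.
  by rewrite sy.
apply: (bij_inj (tb (tau x y))); rewrite [in RHS]e -!braid_tau.
exact: ty.
Qed.

Lemma ret_rel_tau (x x' y y' : S) :
  ret_rel x x' -> ret_rel y y' -> ret_rel (tau x y) (tau x' y').
Proof.
case: ndS => sb tb [sx tx] [sy ty].
have <- : tau x' y = tau x' y' by apply: ty.
have e : sigma x y = sigma x' y by apply: sx.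
split=> w.
  apply: (bij_inj (sb (sigma x y))).
  by rewrite [in RHS]e -!braid_sigma sx.
have [g _ gK] := tb (sigma x y).
rewrite -(gK w) /= -braid_tau e -braid_tau.
by rewrite (tx (g w)).
Qed.

Lemma sigma_Ret (x y : S) :
  @sigma (Ret S) (ret_class x) (ret_class y) = ret_class (sigma x y).
Proof. by apply/ret_classP/ret_rel_sigma; apply: ret_repr_class. Qed.

Lemma tau_Ret (x y : S) :
  @tau (Ret S) (ret_class x) (ret_class y) = ret_class (tau x y).
Proof. by apply/ret_classP/ret_rel_tau; apply: ret_repr_class. Qed.

End WellDefined.

(* Main.v *)
Require Import Defs.
From mathcomp Require Import all_boot.

(** The retraction of a square-free non-degenerate solution is again one: the
    delicate point is that the induced maps are injective when the set of
    classes is infinite.  Put z = sigma_x(y).  Applying the braid relation to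
    (x, x, y), square-freeness gives tau_y(x) = tau_z(x), so w = tau_y(x) is
    determined by x and the class of z.  Hence, in
    sigma_x sigma_y = sigma_z sigma_w and tau_y tau_x = tau_w tau_z, the class
    of z determines that of y; the argument for tau_x is symmetric.
    Transitivity passes to the retraction, so by induction on the level an
    indecomposable solution has a one-point retraction; its maps sigma_x and
    tau_x then do not depend on x, fix every point by square-freeness, and thus
    generate the trivial group. *)

Set Implicit Arguments.
Unset Strict Implicit.

Local Arguments sigma : simpl never.
Local Arguments tau : simpl never.

Lemma square_free_sigma (S : ybe_data) (sfS : square_free S) (x : S) :
  sigma x x = x.
Proof. exact: (congr1 fst (sfS x)). Qed.

Lemma square_free_tau (S : ybe_data) (sfS : square_free S) (x : S) :
  tau x x = x.
Proof. exact: (congr1 snd (sfS x)). Qed.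

Lemma ret_class_ind (S : ybe_data) (P : Ret S -> Prop) :
  (forall x : S, P (ret_class x)) -> forall c, P c.
Proof. by move=> Px c; rewrite -[c]ret_reprK. Qed.

Lemma Ret_square_free (S : ybe_data) : square_free S -> square_free (Ret S).
Proof.
move=> sfS c; rewrite /ybe_map; congr (_, _); rewrite -[RHS]ret_reprK.
  by congr ret_class; apply: square_free_sigma.
by congr ret_class; apply: square_free_tau.
Qed.

Section Retraction.
Variable S : ybe_data.
Hypotheses (solS : is_solution S) (ndS : non_degenerate S).

Lemma Ret_solution : is_solution (Ret S).
Proof.
move=> [[c d] e].
elim/ret_class_ind: c => x; elim/ret_class_ind: d => y.
elim/ret_class_ind: e => z.
have := solS (x, y, z); rewrite /map_l /map_r /ybe_map /=.
by rewrite !(sigma_Ret solS ndS, tau_Ret solS ndS) => -[-> -> ->].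
Qed.

Lemma perm_group_bij (f : S -> S) : perm_group f -> bijective f.
Proof.
elim=> {f} [x|x||f g _ bf _ bg|f g _ _ fK gK].
- exact: ndS.1.
- exact: ndS.2.
- by exists id.
- exact: bij_comp.
- by exists f.
Qed.

Section SquareFree.
Hypothesis sfS : square_free S.

Lemma tau_sigma_square_free (x y : S) : tau x (sigma x y) = tau x y.
Proof.
apply: (bij_inj (ndS.2 (tau x y))).
by rewrite -(braid_tau solS) !square_free_tau.
Qed.

(** The mirror image of the previous identity: here the braid relation is taken at [(x, y, y)]. *)
Lemma sigma_tau_square_free (x y : S) : sigma (tau x y) y = sigma x y.
Proof.
apply: (bij_inj (ndS.1 (sigma x y))).
by rewrite -(braid_sigma solS) !square_free_sigma.
Qed.

Lemma ret_rel_sigma_inj (x y y' : S) :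
  ret_rel (sigma x y) (sigma x y') -> ret_rel y y'.
Proof.
move=> [sz tz].
have e : tau x y = tau x y'.
  by rewrite -tau_sigma_square_free -[RHS]tau_sigma_square_free; apply: tz.
split=> w.
  by apply: (bij_inj (ndS.1 x));
    rewrite (braid_sigma solS x y) (braid_sigma solS x y') sz e.
(* The braid relation computes [tau_y] only after [tau_x], so [w] is written as a value of
   [tau_x]. *)
have [g _ gK] := ndS.2 x.
rewrite -(gK w) /= (braid_tau solS _ x y) (braid_tau solS _ x y') e.
by congr tau; apply: tz.
Qed.

Lemma ret_rel_tau_inj (x y y' : S) :
  ret_rel (tau y x) (tau y' x) -> ret_rel y y'.
Proof.
move=> [sz tz].
have e : sigma y x = sigma y' x.
  by rewrite -sigma_tau_square_free -[RHS]sigma_tau_square_free; apply: sz.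
split=> w.
  have [g _ gK] := ndS.1 x.
  by rewrite -(gK w) (braid_sigma solS y x) (braid_sigma solS y' x) e sz.
apply: (bij_inj (ndS.2 x)).
rewrite (braid_tau solS w y x) (braid_tau solS w y' x) e.
exact: tz.
Qed.

(** Surjectivity descends by inverting [f] on representatives. The inverse of [f] need not respect
    classes, so injectivity comes from [f] reflecting [ret_rel]. *)
Lemma Ret_bijective (f : S -> S) (F : Ret S -> Ret S) :
  (forall x, F (ret_class x) = ret_class (f x)) ->
  (forall x y, ret_rel (f x) (f y) -> ret_rel x y) ->
  bijective f -> bijective F.
Proof.
move=> Ff f_inj [g fK gK].
have GK : cancel (fun c => ret_class (g (ret_repr c))) F.
  by move=> c; rewrite Ff gK ret_reprK.
exists (fun c => ret_class (g (ret_repr c))) => //.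
elim/ret_class_ind=> x; apply/ret_classP/f_inj/ret_classP.
by rewrite -!Ff GK.
Qed.

Lemma Ret_non_degenerate : non_degenerate (Ret S).
Proof.
split; elim/ret_class_ind=> x.
- apply: (Ret_bijective (f := sigma x)) (ndS.1 x) => y; first exact: sigma_Ret.
  by move=> y'; apply: ret_rel_sigma_inj.
- apply: (Ret_bijective (f := (@tau S)^~ x)) (ndS.2 x) => y.
    exact: tau_Ret.
  by move=> y'; apply: ret_rel_tau_inj.
Qed.

End SquareFree.
End Retraction.

Lemma Ret_indecomposable (S : ybe_data) :
  is_solution S -> non_degenerate S -> square_free S ->
  indecomposable S -> indecomposable (Ret S).
Proof.
move=> solS ndS sfS indS.
have lift f : perm_group f -> exists2 F : Ret S -> Ret S, perm_group F &
    forall x, F (ret_class x) = ret_class (f x).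
  elim=> {f} [x|x||f g _ [F pF Ff] _ [G pG Gg]|f g _ [F pF Ff] fK gK].
  - exists (@sigma (Ret S) (ret_class x)); first exact: perm_group_sigma.
    by move=> y; apply: sigma_Ret.
  - exists ((@tau (Ret S))^~ (ret_class x)); first exact: perm_group_tau.
    by move=> y; apply: tau_Ret.
  - by exists id => //; apply: perm_group_id.
  - by exists (F \o G); [apply: perm_group_comp | move=> x; rewrite /= Gg Ff].
  (* A lift of the inverse [g] has to invert [F] on classes; such a [G] exists because the
     retraction is non-degenerate. *)
  - have [G FK GK] := perm_group_bij (Ret_non_degenerate solS ndS sfS) pF.
    exists G; first exact: perm_group_inv pF FK GK.
    by move=> x; rewrite -[x in LHS]gK -Ff FK.
elim/ret_class_ind=> x; elim/ret_class_ind=> y.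
have [f /lift[F pF Ff] <-] := indS x y.
by exists F.
Qed.

Lemma indecomposable_multipermutation_trivial (S : ybe_data) :
  is_solution S -> non_degenerate S -> square_free S ->
  multipermutation S -> indecomposable S -> forall x y : S, x = y.
Proof.
move=> solS ndS sfS [k mpS] indS.
elim: k S solS ndS sfS mpS indS => [|k IHk] S solS ndS sfS.
  by move=> [x0 eqx0] _ x y; rewrite (eqx0 x) (eqx0 y).
(* Peeling off the innermost [Ret] turns [mpS] into a statement about [k] retractions of [Ret S], as
   [IHk] requires. *)
rewrite iterSr => mpS indS.
have rel_all (x y : S) : ret_rel x y.
  apply/ret_classP; apply: (IHk (Ret S)) => //.
  - exact: Ret_solution.
  - exact: Ret_non_degenerate.
  - exact: Ret_square_free.
  - exact: Ret_indecomposable.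
have group_trivial (f : S -> S) : perm_group f -> f =1 id.
  elim=> {f} [x y|x y|//|f g _ f1 _ g1 x|f g _ f1 _ gK x].
  - by rewrite (rel_all x y).1 square_free_sigma.
  - by rewrite (rel_all x y).2 square_free_tau.
  - by rewrite /= g1 f1.
  - by rewrite -[LHS]f1 gK.
by move=> x y; have [f /group_trivial f1 <-] := indS x y; rewrite f1.
Qed.

Theorem corollary5p7 (S : ybe_data) (S_nontrivial : exists x y : S, x <> y) :
  is_solution S -> non_degenerate S -> multipermutation S -> square_free S ->
  decomposable S.
Proof.
move=> solS ndS mpS sfS indS; have [x [y]] := S_nontrivial; apply.
exact: indecomposable_multipermutation_trivial.
Qed.
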